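(* Let $H\colon T^*\mathbb{R}^d\to\mathbb{R}$ be smooth and let $\hat\Phi_{(\cdot)}\colon\mathbb{R}\times T^*\mathbb{R}^{2d}\to T^*\mathbb{R}^{2d}$ be the discrete flow defined by an integrator for the extended Hamiltonian system (see context). For any $\bar z_n\in T^*\mathbb{R}^d$, there exist a neighborhood $U$ of $\bar z_n$ in $T^*\mathbb{R}^d$, a number $\varepsilon>0$, and maps $\mu_{(\cdot)}\colon(-\varepsilon,\varepsilon)\times U\to\mathbb{R}^{2d}$ and $\Phi_{(\cdot)}\colon(-\varepsilon,\varepsilon)\times U\to T^*\mathbb{R}^d$ such that, for any $\Delta t\in(-\varepsilon,\varepsilon)$ and any $z_n\in U$, $$\iota\circ\Phi_{\Delta t}(z_n)=\hat\Phi_{\Delta t}\bigl(\iota(z_n)+A^T\mu_{\Delta t}(z_n)\bigr)+A^T\mu_{\Delta t}(z_n).$$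
   Context: Notation. $d\ge 1$; $T^*\mathbb{R}^d\cong\mathbb{R}^{2d}$ has coordinates $z=(q,p)$, and $T^*\mathbb{R}^{2d}\cong\mathbb{R}^{4d}$ has coordinates $\zeta=(q,x,p,y)$ with $q,x,p,y\in\mathbb{R}^d$. $D_i$ denotes the partial derivative with respect to the $i$-th set of variables. Extended Hamiltonian system on $T^*\mathbb{R}^{2d}$ for a smooth $H\colon T^*\mathbb{R}^d\to\mathbb{R}$: $\dot q=D_2H(x,p)$, $\dot x=D_2H(q,y)$, $\dot p=-D_1H(q,y)$, $\dot y=-D_1H(x,p)$. Write $\hat X$ for its vector field. An integrator for it is a smooth map $\mathbb{R}\times T^*\mathbb{R}^{2d}\to T^*\mathbb{R}^{2d}$, $(h,\zeta)\mapsto\hat\Phi_h(\zeta)$, with $\hat\Phi_0=\mathrm{id}$ and $\frac{\partial}{\partial h}\hat\Phi_h(\zeta)|_{h=0}=\hat X(\zeta)$. Let $\iota\colon T^*\mathbb{R}^d\to T^*\mathbb{R}^{2d}$, $\iota(q,p)=(q,q,p,p)$, and let $A\colon\mathbb{R}^{4d}\to\mathbb{R}^{2d}$ be the linear map $A(q,x,p,y)=(q-x,p-y)$, so that $A^T(\mu_1,\mu_2)=(\mu_1,-\mu_1,\mu_2,-\mu_2)$ for $\mu_1,\mu_2\in\mathbb{R}^d$. *)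

(* Defs.v *)
From HB Require Import structures.
From mathcomp Require Import all_boot all_order all_algebra.
From mathcomp Require Import all_classical all_reals all_analysis.

Set Implicit Arguments.
Unset Strict Implicit.
Unset Printing Implicit Defensive.

Import Order.TTheory GRing.Theory Num.Theory.
Import numFieldNormedType.Exports.

Local Open Scope classical_set_scope.
Local Open Scope ring_scope.

(* Points are column vectors: z = (q, p) is col_mx q p, and
   zeta = (q, x, p, y) is col_mx (col_mx q x) (col_mx p y). *)
Notation "''T*Q' [ R ]_ d" := ('cV[R]_(d + d))
  (at level 8, d at level 2, format "''T*Q' [ R ]_ d") : type_scope.
Notation "''T*QQ' [ R ]_ d" := ('cV[R]_((d + d) + (d + d)))
  (at level 8, d at level 2, format "''T*QQ' [ R ]_ d") : type_scope.

Section smoothness.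
Context {R : realType} {V W : normedModType R}.

(* f is of class C^k; meant for V finite-dimensional, where having continuous
   directional derivatives in every direction is being C^1. *)
Fixpoint is_Ck (k : nat) (f : V -> W) : Prop :=
  if k is k'.+1 then
    continuous f /\
    forall v, (forall x, derivable f x v) /\ is_Ck k' ('D_v f)
  else continuous f.

Definition smooth (f : V -> W) := forall k, is_Ck k f.

End smoothness.

Section extended_system.
Context {R : realType} {d : nat}.
Implicit Types (H : 'T*Q[R]_d -> R) (q p : 'cV[R]_d) (z : 'T*Q[R]_d).

Definition D1 H q p : 'cV[R]_d :=
  \col_i 'D_(delta_mx i 0) (fun q' => H (col_mx q' p)) q.

Definition D2 H q p : 'cV[R]_d :=
  \col_i 'D_(delta_mx i 0) (fun p' => H (col_mx q p')) p.

Definition ext_vector_field H (zeta : 'T*QQ[R]_d) : 'T*QQ[R]_d :=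
  let q := usubmx (usubmx zeta) in let x := dsubmx (usubmx zeta) in
  let p := usubmx (dsubmx zeta) in let y := dsubmx (dsubmx zeta) in
  col_mx (col_mx (D2 H x p) (D2 H q y)) (col_mx (- D1 H q y) (- D1 H x p)).

Definition is_integrator H (Phi : R -> 'T*QQ[R]_d -> 'T*QQ[R]_d) : Prop :=
  [/\ smooth (fun u : R * 'T*QQ[R]_d => Phi u.1 u.2),
      forall zeta, Phi 0 zeta = zeta &
      forall zeta, is_derive (0 : R) 1 (fun h => Phi h zeta)
                             (ext_vector_field H zeta)].

Definition iota_diag z : 'T*QQ[R]_d :=
  col_mx (col_mx (usubmx z) (usubmx z)) (col_mx (dsubmx z) (dsubmx z)).

Definition Amx : 'M[R]_(d + d, (d + d) + (d + d)) :=
  block_mx (row_mx 1%:M (- 1%:M)) 0 0 (row_mx 1%:M (- 1%:M)).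

Lemma mul_Amx q x p y :
  Amx *m col_mx (col_mx q x) (col_mx p y) = col_mx (q - x) (p - y).
Proof.
by rewrite /Amx mul_block_col !mul_row_col !mul0mx !mulNmx !mul1mx addr0 add0r.
Qed.

Lemma mul_trAmx (mu1 mu2 : 'cV[R]_d) :
  Amx^T *m col_mx mu1 mu2 = col_mx (col_mx mu1 (- mu1)) (col_mx mu2 (- mu2)).
Proof.
rewrite /Amx tr_block_mx !tr_row_mx !linearN /= !trmx1 !trmx0 mul_block_col.
by rewrite !mul_col_mx !mul0mx !mulNmx !mul1mx addr0 add0r.
Qed.

End extended_system.
Arguments Amx : clear implicits.

(* Main.v *)
Require Import Defs.
From HB Require Import structures.
From mathcomp Require Import all_boot all_order all_algebra.
From mathcomp Require Import all_classical all_reals all_analysis.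
From mathcomp Require Import lra.
Import Order.TTheory GRing.Theory Num.Theory.
Import numFieldNormedType.Exports.
Local Open Scope classical_set_scope.
Local Open Scope ring_scope.

(* Since the kernel of A is the image of iota, it suffices to find mu with
   A (Phihat_dt (iota z + A^T mu) + A^T mu) = 0. As A iota = 0 and A A^T = 2,
   this is the fixed point equation
     mu = - 1/4 A (Phihat_dt (iota z + A^T mu) - A^T mu).
   At dt = 0 the right-hand side does not depend on mu and is 0, and the partial
   derivatives of Phihat are continuous, so for (dt, z) near (0, zbar) it is a
   contraction of a small closed ball around 0. *)

Lemma le_mx_norm {R : realType} {m n} (A : 'M[R]_(m, n)) i j : `|A i j| <= `|A|.
Proof.
rewrite [leRHS]/Num.Def.normr/= mx_normrE.
exact: (@le_bigmax _ _ _ _ (fun ij => `|A ij.1 ij.2|) (i, j)).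
Qed.

Lemma mx_norm_le {R : realType} {m n} (A : 'M[R]_(m, n)) (c : R) :
  0 <= c -> (forall i j, `|A i j| <= c) -> `|A| <= c.
Proof.
by move=> c0 Ac; rewrite [leLHS]/Num.Def.normr/= mx_normrE; apply: bigmax_le.
Qed.

Lemma mx_norm_mulmx {R : realType} {m n p}
    (A : 'M[R]_(m, n)) (B : 'M[R]_(n, p)) :
  `|A *m B| <= n%:R * `|A| * `|B|.
Proof.
apply: mx_norm_le => [|i j]; first by rewrite !mulr_ge0.
rewrite mxE (le_trans (ler_norm_sum _ _ _))//.
have -> : n%:R * `|A| * `|B| = \sum_(k < n) `|A| * `|B|.
  by rewrite sumr_const card_ord -mulrA mulr_natl.
rewrite ler_sum// => k _.
by rewrite normrM ler_pM// le_mx_norm.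
Qed.

(** The scalar mean value theorem is applied to each entry along the line; the max norm combines the
    entrywise bounds without loss, so [K] survives unchanged. *)
Lemma line_mean_value (R : realType) (V : normedModType R) m
    (f : V -> 'cV[R]_m) (x v : V) (a b K : R) :
  a <= b -> 0 <= K ->
  (forall t, a <= t <= b -> derivable f (t *: v + x) v) ->
  (forall t, a <= t <= b -> `|'D_v f (t *: v + x)| <= K) ->
  `|f (b *: v + x) - f (a *: v + x)| <= K * (b - a).
Proof.
move=> ab K0 df Dle.
have ba0 : 0 <= b - a by rewrite subr_ge0.
apply: mx_norm_le => [|i j]; first by rewrite mulr_ge0.
pose g t := f (t *: v + x) i j.
have dg t : a <= t <= b -> is_derive t 1 g ('D_v f (t *: v + x) i j).
  move=> /df dft; have /derivable_mxP/(_ i j) dfij := dft.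
  rewrite (derive_mx dft) [X in is_derive _ _ _ X]mxE.
  have E : (fun h : R => h^-1 *: (g (h *: 1 + t) - g t)) =
      (fun h => h^-1 *: (f (h *: v + (t *: v + x)) i j - f (t *: v + x) i j)).
    by apply/funext => h; rewrite /g scaler1 scalerDl addrA.
  by split; rewrite /derivable/derive /= E.
have [||c cab] := @MVT_segment _ g (fun t => 'D_v f (t *: v + x) i j) a b ab.
- by move=> t /itvP tab; apply: dg; rewrite !tab.
- apply: derivable_within_continuous => t /itvP tab.
  by have [] := dg t _; rewrite ?tab.
rewrite !mxE -[_ - _]/(g b - g a) => ->.
rewrite normrM (ger0_norm ba0) ler_wpM2r//.
rewrite (le_trans (le_mx_norm _ _ _))// Dle//.
Qed.

(** Changing one coordinate at a time costs the factor [n] but uses only partial derivatives, which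
    is the kind of information that [smooth] provides. *)
Lemma lipschitz_of_partials {R : realType} {n m} {F : 'cV[R]_n -> 'cV[R]_m}
    {r K : R} :
  0 <= K ->
  (forall w i, derivable F w (delta_mx i 0)) ->
  (forall w i, `|w| <= r -> `|'D_(delta_mx i 0) F w| <= K) ->
  forall w w', `|w| <= r -> `|w'| <= r -> `|F w - F w'| <= n%:R * K * `|w - w'|.
Proof.
move=> K0 dF DF w w' wr w'r.
have r0 : 0 <= r by exact: le_trans wr.
(* [path k] agrees with [w] in the first [k] coordinates and with [w'] in the
   others, so it stays in the ball, which is a box for the max norm. *)
pose path k : 'cV[R]_n := \col_i (if (i < k)%N then w i 0 else w' i 0).
have step (k : 'I_n) : `|F (path k.+1) - F (path k)| <= K * `|w - w'|.
  (* The common part of [path k] and [path k.+1], with coordinate [k] set to 0: both points lie on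
     the line through [x] in direction [k], at parameters [w' k 0] and [w k 0]. *)
  pose x : 'cV[R]_n :=
    \col_i (if i == k then 0 else if (i < k)%N then w i 0 else w' i 0).
  have pathS : path k.+1 = w k 0 *: delta_mx k 0 + x.
    apply/colP => i; rewrite !mxE eqxx andbT ltnS leq_eqVlt -val_eqE /=.
    by case: eqVneq => [/val_inj->|_]; rewrite /= ?mulr1 ?mulr0 ?addr0 ?add0r.
  have pathE : path k = w' k 0 *: delta_mx k 0 + x.
    apply/colP => i; rewrite !mxE eqxx andbT -val_eqE /=.
    case: eqVneq => [/val_inj->|_]; rewrite /= ?mulr1 ?mulr0 ?addr0 ?add0r//.
    by rewrite ltnn.
  have xr (a b t : R) : `|a| <= r -> `|b| <= r -> a <= t <= b ->
      `|t *: delta_mx k 0 + x| <= r.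
    move=> ar br /andP[at_ tb]; apply: mx_norm_le => // i j.
    rewrite !mxE (ord1 j) eqxx andbT.
    case: eqVneq => _; rewrite /= ?mulr1 ?mulr0 ?addr0 ?add0r.
      move: ar br; rewrite !ler_norml => /andP[ra _] /andP[_ br].
      by rewrite (le_trans ra at_) (le_trans tb br).
    by case: ifP => _; rewrite (le_trans (le_mx_norm _ _ _)).
  have wk : `|w k 0| <= r by rewrite (le_trans (le_mx_norm _ _ _)).
  have w'k : `|w' k 0| <= r by rewrite (le_trans (le_mx_norm _ _ _)).
  have wwk : `|w k 0 - w' k 0| <= `|w - w'|.
    by have := le_mx_norm (w - w') k 0; rewrite !mxE.
  rewrite pathS pathE.
  have [le|/ltW le] := leP (w' k 0) (w k 0).
    apply: le_trans (@line_mean_value _ _ _ _ _ _ _ _ K le _ _ _) _ => //.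
    - by move=> t tab; apply: DF; exact: xr tab.
    - by rewrite ler_wpM2l// -[leLHS]ger0_norm// subr_ge0.
  rewrite distrC.
  apply: le_trans (@line_mean_value _ _ _ _ _ _ _ _ K le _ _ _) _ => //.
  - by move=> t tab; apply: DF; exact: xr tab.
  - by rewrite ler_wpM2l// -[leLHS]ger0_norm ?subr_ge0// distrC.
have -> : n%:R * K * `|w - w'| = \sum_(k < n) K * `|w - w'|.
  by rewrite sumr_const card_ord -mulrA mulr_natl.
have -> : F w = F (path n) by congr F; apply/colP => i; rewrite mxE ltn_ord.
have -> : F w' = F (path 0%N) by congr F; apply/colP => i; rewrite mxE.
rewrite -(@telescope_sumr _ 0 n (F \o path))// big_mkord.
rewrite (le_trans (ler_norm_sum _ _ _))//.
by rewrite ler_sum// => k _; exact: step.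
Qed.

(** Banach's theorem on the closed ball, which [T] preserves since |T w| <= |T w - T 0| + |T 0| <=
    r/2 + r/2. *)
Lemma ball_fixed_point (R : realType) n (T : 'cV[R]_n -> 'cV[R]_n) (r : R) :
  0 <= r ->
  (forall w w', `|w| <= r -> `|w'| <= r -> `|T w - T w'| <= 2^-1 * `|w - w'|) ->
  `|T 0| <= r / 2 ->
  exists w, w = T w.
Proof.
move=> r0 lipT T0.
pose X : completeNormedModType R := HB.pack 'cV[R]_n
  (NormedModule.on 'cV[R]_n) (Complete.on 'cV[R]_n).
pose B : set X := [set w : X | `|w| <= r].
have TB : set_fun B B (T : X -> X).
  move=> w Bw /=; rewrite /B /=.
  have := lipT w 0 Bw; rewrite normr0 subr0 => /(_ r0) Tw.
  rewrite -[T w](subrK (T 0)) (le_trans (ler_normD _ _))//.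
  move: Bw; rewrite /B /= => Bw; lra.
pose T' : {fun B >-> B} := HB.pack (T : X -> X) (isFun.Build _ _ _ _ _ TB).
have [|||w _ wT] := @banach_fixed_point R X B T'; last by exists w.
- exists (2^-1)%:nng; split => /=; first by lra.
  by move=> [w w'] [/= Bw Bw']; exact: lipT.
- have -> : B = (fun w : X => `|w|) @^-1` [set t : R | t <= r] by [].
  by apply: (closed_comp _ (@closed_le _ r)) => w _; exact: norm_continuous.
- by exists 0; rewrite /B /= normr0.
Qed.

(** The matrix of [iota_diag], so that [mx_norm_mulmx] gives its Lipschitz bound. *)
Definition iota_mx (R : realType) d : 'M[R]_((d + d) + (d + d), d + d) :=
  block_mx (col_mx 1%:M 1%:M) 0 0 (col_mx 1%:M 1%:M).

Lemma iota_mxE (R : realType) d (z : 'T*Q[R]_d) :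
  iota_diag z = iota_mx R d *m z.
Proof.
rewrite -{2}(vsubmxK z) /iota_mx mul_block_col !mul0mx addr0 add0r.
by rewrite !mul_col_mx !mul1mx.
Qed.

Lemma Amx_iota (R : realType) d (z : 'T*Q[R]_d) : Amx R d *m iota_diag z = 0.
Proof. by rewrite /iota_diag mul_Amx !subrr col_mx0. Qed.

Lemma Amx_trAmx (R : realType) d (mu : 'cV[R]_(d + d)) :
  Amx R d *m ((Amx R d)^T *m mu) = 2 *: mu.
Proof.
rewrite -{1}(vsubmxK mu) mul_trAmx mul_Amx !opprK -add_col_mx vsubmxK.
by rewrite scalerDl scale1r.
Qed.

Lemma Amx_ker (R : realType) d (w : 'T*QQ[R]_d) : Amx R d *m w = 0 ->
  iota_diag (col_mx (usubmx (usubmx w)) (usubmx (dsubmx w))) = w.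
Proof.
rewrite -{1 4}(vsubmxK w) -{1 3}(vsubmxK (usubmx w)) -{1 3}(vsubmxK (dsubmx w)).
rewrite mul_Amx -[0 in RHS]col_mx0 => /eq_col_mx[/subr0_eq qx /subr0_eq py].
by rewrite /iota_diag !(col_mxKu, col_mxKd) -qx -py.
Qed.

(** For nonzero [h] the difference quotient is constantly [dg]. *)
Lemma is_derive_affine (R : realType) (V W : normedModType R) (g : V -> W)
    (x v : V) (dg : W) :
  (forall h : R, g (h *: v + x) = h *: dg + g x) -> is_derive x v g dg.
Proof.
move=> gE.
have gdg : h^-1 *: (g (h *: v + x) - g x) @[h --> (0 : R)^'] --> dg.
  apply: cvg_near_cst; near=> h.
  have h0 : h != 0 by near: h; exact: nbhs_dnbhs_neq.
  by rewrite gE addrK scalerA mulVf// scale1r.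
by split; [apply/cvg_ex; exists dg | exact: cvg_lim].
Unshelve. all: by end_near. Qed.

(** As [g] carries the line in direction [v'] to a line in direction [v], the two difference
    quotients are the same function of [h]. *)
Lemma is_derive_slice (R : realType) (V W V' : normedModType R)
    (f : R * V -> W) (g : V' -> V) (t : R) (x v' : V') (v : V) :
  (forall h : R, g (h *: v' + x) = h *: v + g x) ->
  derivable f (t, g x) (0, v) ->
  is_derive x v' (fun x => f (t, g x)) ('D_(0, v) f (t, g x)).
Proof.
move=> gE df.
have E : (fun h : R => h^-1 *: (f (t, g (h *: v' + x)) - f (t, g x))) =
   (fun h : R => h^-1 *: (f (h *: (0, v) + (t, g x)) - f (t, g x))).
  apply/funext => h; rewrite gE; congr (_ *: (f (_, _) - _)).
  by rewrite /= scaler0 add0r.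
by split; rewrite /derivable /derive /= E.
Qed.

Theorem proposition2 (R : realType) (d : nat) (hd : (0 < d)%N)
    (H : 'T*Q[R]_d -> R) (hH : smooth H)
    (Phihat : R -> 'T*QQ[R]_d -> 'T*QQ[R]_d) (hPhihat : is_integrator H Phihat)
    (zbar : 'T*Q[R]_d) :
  exists (U : set 'T*Q[R]_d) (eps : R)
         (mu : R -> 'T*Q[R]_d -> 'cV[R]_(d + d))
         (Phi : R -> 'T*Q[R]_d -> 'T*Q[R]_d),
    [/\ nbhs zbar U, 0 < eps &
        forall (dt : R) (z : 'T*Q[R]_d), - eps < dt < eps -> U z ->
          iota_diag (Phi dt z) =
            Phihat dt (iota_diag z + (Amx R d)^T *m mu dt z)
            + (Amx R d)^T *m mu dt z].
Proof.
have [smP Phi0 _] := hPhihat.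
pose P := fun u : R * 'T*QQ[R]_d => Phihat u.1 u.2.
have [cP dP] := smP 1%N.
pose A := Amx R d.
pose v i : 'T*QQ[R]_d := A^T *m delta_mx i 0.
pose cA : R := (d + d + (d + d))%:R * `|A|.
pose cAT : R := (d + d)%:R * `|A^T|.
pose cI : R := (d + d)%:R * `|iota_mx R d|.
have cA0 : 0 <= cA by rewrite mulr_ge0.
have cAT0 : 0 <= cAT by rewrite mulr_ge0.
have cI0 : 0 <= cI by rewrite mulr_ge0.
(* Dividing by [a + 1] rather than [a] allows for a constant [a] equal to 0. *)
have fracP (a b : R) : 0 <= a -> 0 < b ->
    0 < b / (a + 1) /\ a * (b / (a + 1)) <= b.
  move=> a0 b0; have a1 : 0 < a + 1 by lra.
  split; first exact: divr_gt0.
  by rewrite mulrA ler_pdivrMr// mulrC ler_pM2l//; lra.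
have dP0 w u : is_derive ((0, w) : R * 'T*QQ[R]_d) (0, u) P u.
  by apply: is_derive_affine => h; rewrite /P /= scaler0 addr0 !Phi0.
(* [F] below will have Lipschitz constant (d + d) delta; this [delta] makes [A *m F] 1-Lipschitz. *)
have [delta0 delta_le] := fracP _ _ (mulr_ge0 cA0 (ler0n R (d + d))) ltr01.
set delta := 1 / _ in delta0 delta_le.
(* Continuity of finitely many derivatives, each equal to [v i] at time 0 by [dP0]. *)
have : nbhs ((0, iota_diag zbar) : R * 'T*QQ[R]_d)
    [set u | forall i, `|'D_(0, v i) P u - v i| <= delta].
  apply: (@filter_forall (R * 'T*QQ[R]_d)%type _ _ (nbhs _)) => i.
  have /(_ (0, iota_diag zbar)) cD : continuous ('D_(0, v i) P).
    exact: (dP _).2.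
  move/cvgrPdist_le : cD => /(_ _ delta0); apply: filterS => u /=.
  by rewrite (@derive_val _ _ _ _ _ _ _ (dP0 _ _)) distrC.
move=> /nbhs_ballP[e /= e0 De].
have e30 : 0 < e / 3 by rewrite divr_gt0.
(* [r] keeps |A^T mu| <= e/3 on the ball of radius [r]; [eta] then gives |A (F 0)| <= r. *)
have [r0 r_le] := fracP _ _ cAT0 e30.
set r := (e / 3) / _ in r0 r_le.
have [eta0 eta_le] := fracP _ _ cA0 r0.
set eta := r / _ in eta0 eta_le.
have : nbhs ((0, iota_diag zbar) : R * 'T*QQ[R]_d)
    [set u | `|P u - iota_diag zbar| <= eta].
  have := cP (0, iota_diag zbar); move/cvgrPdist_le => /(_ _ eta0).
  by apply: filterS => u /=; rewrite Phi0 distrC.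
move=> /nbhs_ballP[e' /= e'0 Pe'].
(* The shift of [iota_diag z] and that of [A^T *m mu] add up to at most 2e/3 < e; without the
   latter, m <= e'/2 stays inside the ball of radius [e']. *)
pose m := Num.min (e / 3) (e' / 2).
have m0 : 0 < m by rewrite lt_min e30 divr_gt0.
have [me me'] : m <= e / 3 /\ m <= e' / 2 by split; rewrite ge_min lexx ?orbT.
have [s0' s_le] := fracP _ _ cI0 m0.
pose s := Num.min m (m / (cI + 1)).
have s0 : 0 < s by rewrite lt_min m0 s0'.
have sm : s <= m by rewrite ge_min lexx.
have sm' : s <= m / (cI + 1) by rewrite ge_min lexx orbT.
have near_iota z : ball zbar s z -> `|iota_diag zbar - iota_diag z| <= m.
  rewrite -ball_normE /= => zs; rewrite !iota_mxE -mulmxBr.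
  apply: le_trans (mx_norm_mulmx _ _) _; rewrite -/cI.
  apply: le_trans s_le; rewrite ler_wpM2l//.
  by rewrite (le_trans _ sm')// ltW.
have sol (dt : R) z : - s < dt < s -> ball zbar s z ->
    exists mu, A *m (Phihat dt (iota_diag z + A^T *m mu) + A^T *m mu) = 0.
  move=> /andP[sdt dts] zs.
  have dts' : `|0 - dt| < s by rewrite sub0r normrN ltr_norml sdt.
  (* Subtracting [A^T *m mu] cancels the derivative at time 0, so the partial derivatives of [F] are
     small nearby. *)
  pose F mu : 'T*QQ[R]_d := P (dt, iota_diag z + A^T *m mu) - A^T *m mu.
  have dF mu i : is_derive mu (delta_mx i 0) F
      ('D_(0, v i) P (dt, iota_diag z + A^T *m mu) - v i).
    apply: is_deriveB.
      apply: (@is_derive_slice _ _ _ _ P (fun mu => iota_diag z + A^T *m mu)).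
        by move=> h; rewrite mulmxDr -scalemxAr addrCA.
      exact: (dP _).1.
    by apply: is_derive_affine => h; rewrite mulmxDr -scalemxAr.
  have DF mu i : `|mu| <= r -> `|'D_(delta_mx i 0) F mu| <= delta.
    move=> mur; rewrite (@derive_val _ _ _ _ _ _ _ (dF mu i)).
    apply: (De _ _ i); split; rewrite -ball_normE /=; first by lra.
    rewrite opprD addrA (le_lt_trans (ler_normB _ _))//.
    have := near_iota _ zs.
    have : `|A^T *m mu| <= e / 3.
      apply: le_trans (mx_norm_mulmx _ _) _; rewrite -/cAT.
      by apply: le_trans r_le; rewrite ler_wpM2l.
    lra.
  have [|||mu muE] := @ball_fixed_point R _ (fun mu => - 4^-1 *: (A *m F mu)) r.
  - exact: ltW.
  - move=> w w' wr w'r; rewrite -scalerBr -mulmxBr normrZ.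
    have dF' w0 i : derivable F w0 (delta_mx i 0) by case: (dF w0 i).
    have FL := lipschitz_of_partials (ltW delta0) dF' DF _ _ wr w'r.
    have AF : `|A *m (F w - F w')| <= `|w - w'|.
      apply: le_trans (mx_norm_mulmx _ _) _; rewrite -/cA.
      apply: le_trans (ler_wpM2l cA0 FL) _.
      by rewrite mulrA [cA * _]mulrA ler_piMl // normr_ge0.
    by rewrite normrN gtr0_norm ?invr_gt0// ler_pM //; lra.
  - rewrite /F mulmx0 addr0 subr0 normrZ normrN gtr0_norm ?invr_gt0//.
    (* [A] kills [iota_diag zbar], so subtracting it changes nothing and leaves a small vector. *)
    have -> : A *m P (dt, iota_diag z) =
        A *m (P (dt, iota_diag z) - iota_diag zbar).
      by rewrite mulmxBr Amx_iota subr0.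
    have APr : `|A *m (P (dt, iota_diag z) - iota_diag zbar)| <= r.
      apply: le_trans (mx_norm_mulmx _ _) _; rewrite -/cA.
      apply: le_trans eta_le; rewrite ler_wpM2l//.
      apply: Pe'; split; rewrite -ball_normE /=; first by lra.
      by have := near_iota _ zs; lra.
    lra.
  (* The fixed point equation reads mu = - 1/4 (A P - 2 mu), that is, A P + 2 mu = 0. *)
  exists mu; move: muE; rewrite /F mulmxBr Amx_trAmx => muE.
  rewrite mulmxDr Amx_trAmx -/A -[Phihat _ _]/(P (dt, _)).
  move: (A *m P _) muE => B muE.
  apply/colP => i; have := congr1 (fun M : 'cV[R]__ => M i 0) muE.
  by rewrite !mxE; lra.
exists (ball zbar s), s.
pose w dt z mu := Phihat dt (iota_diag z + A^T *m mu) + A^T *m mu.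
(* A choice of solution, with default 0 where there is none; [sol] excludes that case in the
   required range. *)
pose mu dt z := xget 0 [set mu | A *m w dt z mu = 0].
exists mu, (fun dt z => col_mx (usubmx (usubmx (w dt z (mu dt z))))
                               (usubmx (dsubmx (w dt z (mu dt z))))).
split=> // [|dt z dts zs]; first exact: nbhsx_ballx.
by have /= := xgetPex 0 (sol dt z dts zs); exact: Amx_ker.
Qed.
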